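(* Let $\mathcal R_2$ denote the set of partitions in which any two parts differ by at least 2 and in which 1 is not a part, and let $A_{7,1}(n)$ denote the number of partitions of $n$ into parts $\not\equiv 0,\pm1\pmod 7$. Then, for every $n\ge 0$, $$A_{7,1}(n)=\sum_{\tilde\pi\in\mathcal R_2,\ \sigma(\tilde\pi)=n}\omega_7(\tilde\pi),$$ where $\omega_7(\tilde\pi)$ is the product of Fibonacci-number weights of the strings of $\tilde\pi$ defined in the context.
   Context: For a partition $\pi$, $\sigma(\pi)$ denotes the sum of its parts. The Fibonacci numbers are $F_0=0$, $F_1=1$, $F_n=F_{n-1}+F_{n-2}$ for $n\ge2$. Given $\tilde\pi\in\mathcal R_2$, a string $\psi$ in $\tilde\pi$ is a maximal sequence of parts of $\tilde\pi$ in which the difference between consecutive parts is $\le 3$ (so every such difference is 2 or 3, and distinct strings are separated by gaps $\ge4$). Every $\tilde\pi\in\mathcal R_2$ decomposes uniquely into strings. For a string $\psi$, let $\eta=\eta(\psi)$ be the number of gaps (differences between consecutive parts) in $\psi$ equal to 3. Writing $j\in\psi$ to mean that $j$ is a part in $\psi$, the weight of $\psi$ is $$\omega_7(\psi)=\begin{cases}F_{\eta+3},&\text{if all parts of }\psi\text{ are}\ge4,\\ F_{\eta+2},&\text{if either }(2\in\psi,\ 4\notin\psi\text{ and }5\notin\psi)\text{ or }3\in\psi,\\ F_{\eta+1},&\text{if }2\in\psi\text{ and either }4\in\psi\text{ or }5\in\psi.\end{cases}$$ The weight of $\tilde\pi$ is $\omega_7(\tilde\pi)=\prod_{\psi}\omega_7(\psi)$,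 the product over all strings $\psi$ of $\tilde\pi$ (the empty product is 1). *)

(* Defs.v *)
From mathcomp Require Import all_boot.

Set Implicit Arguments.
Unset Strict Implicit.
Unset Printing Implicit Defensive.

(* Partitions are weakly decreasing sequences of positive integers; the sum
   sigma(pi) of the parts of pi is [sumn pi]. *)
Definition is_partition (pi : seq nat) : bool :=
  sorted geq pi && all (leq 1) pi.

(* A partition of n has at most n parts, each at most n, so that the partitions
   of n form a subset of the finite type [n.-bseq 'I_n.+1]; [bseq_to_partition]
   and [parts_inj] show that nothing is lost or counted twice. *)
Definition parts (n : nat) (b : n.-bseq 'I_n.+1) : seq nat :=
  [seq val i | i <- b].

Definition partitions (n : nat) : {set n.-bseq 'I_n.+1} :=
  [set b | is_partition (parts b) && (sumn (parts b) == n)].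

Lemma parts_inj n : injective (@parts n).
Proof. by move=> b c /(inj_map val_inj) /val_inj. Qed.

Lemma bseq_to_partition n (pi : seq nat) :
  is_partition pi -> sumn pi = n ->
  exists2 b, b \in partitions n & parts b = pi.
Proof.
move=> is_pi sum_pi.
have pos_pi : all (leq 1) pi by case/andP: is_pi.
have size_pi : size [seq inord i : 'I_n.+1 | i <- pi] <= n.
  rewrite size_map -sum_pi; elim: pi pos_pi {is_pi sum_pi} => //= x s IHs.
  by case/andP=> x_gt0 /IHs le_s; rewrite -add1n leq_add.
have le_pi x : x \in pi -> x <= n.
  rewrite -sum_pi; elim: pi {is_pi sum_pi pos_pi size_pi} => //= y s IHs.
  by rewrite inE => /predU1P[->|/IHs/leq_trans->//]; rewrite ?leq_addr ?leq_addl.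
have parts_pi : parts (Bseq size_pi) = pi.
  rewrite /parts /= -map_comp -[RHS]map_id; apply/eq_in_map => x /le_pi le_x.
  by rewrite /= inordK.
by exists (Bseq size_pi); rewrite // inE parts_pi is_pi sum_pi eqxx.
Qed.

Definition A7_1 (n : nat) : nat :=
  #|[set b in partitions n | all (fun p => p %% 7 \notin [:: 0; 1; 6]) (parts b)]|.

Definition R2 (pi : seq nat) : bool :=
  [&& is_partition pi, pairwise (fun x y => y + 2 <= x) pi & 1 \notin pi].

Fixpoint fib (n : nat) : nat :=
  match n with
  | 0 => 0
  | 1 => 1
  | (n1.+1 as n2).+1 => fib n2 + fib n1
  end.

(* Lists are decreasing, so the truncated subtraction is the actual gap. *)
Definition gaps_le3 (psi : seq nat) : bool := sorted (fun x y => x - y <= 3) psi.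

Definition segments (pi : seq nat) : seq (seq nat) :=
  undup [seq take k (drop i pi) | i <- iota 0 (size pi).+1,
                                  k <- iota 0 (size pi).+1].

Lemma mem_segments pi psi : (psi \in segments pi) = infix psi pi.
Proof.
rewrite mem_undup; apply/allpairsP/idP => [[[i k] [_ _ ->]] /= | psi_pi].
  exact/(infix_trans (prefixW (prefix_take _ _)))/suffixW/suffix_drop.
exists (infix_index psi pi, size psi); rewrite !mem_iota !ltnS /=.
by rewrite infixTindex size_infix //; move: psi_pi; rewrite infixE => /eqP->.
Qed.

(* Without nonemptiness the empty partition would have the empty string. *)
Definition is_string (pi psi : seq nat) : bool :=
  [&& psi != [::], infix psi pi, gaps_le3 psi &
      all (fun phi => infix psi phi && gaps_le3 phi ==> (phi == psi))
          (segments pi)].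

Lemma is_stringP pi psi :
  reflect [/\ psi <> [::], infix psi pi, gaps_le3 psi &
              forall phi, infix phi pi -> infix psi phi -> gaps_le3 phi ->
              phi = psi]
          (is_string pi psi).
Proof.
apply: (iffP and4P) => -[psi0 psi_pi psi3 psi_max]; split=> //.
- exact/eqP.
- move=> phi phi_pi psi_phi phi3; apply/eqP.
  have := allP psi_max phi; rewrite mem_segments psi_phi phi3.
  exact.
- exact/eqP.
apply/allP=> phi; rewrite mem_segments => phi_pi.
by apply/implyP=> /andP[psi_phi phi3]; rewrite (psi_max phi).
Qed.

(* As the parts of an element of R2 are distinct, a string of it is determined
   by its list of parts, and so occurs exactly once here. *)
Definition strings (pi : seq nat) : seq (seq nat) :=
  [seq psi <- segments pi | is_string pi psi].

Definition eta (psi : seq nat) : nat :=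
  count (fun xy => xy.1 - xy.2 == 3) (zip psi (behead psi)).

(* The three cases are exhaustive for nonempty lists of parts >= 2, so the last
   branch is never reached on a string of an element of R2. *)
Definition omega7_string (psi : seq nat) : nat :=
  if all (leq 4) psi then fib (eta psi + 3)
  else if [&& 2 \in psi, 4 \notin psi & 5 \notin psi] || (3 \in psi)
  then fib (eta psi + 2)
  else if (2 \in psi) && ((4 \in psi) || (5 \in psi)) then fib (eta psi + 1)
  else 0.

Definition omega7 (pi : seq nat) : nat :=
  \prod_(psi <- strings pi) omega7_string psi.

(* Main.v *)
Require Import Defs.
From mathcomp Require Import all_boot.
From mathcomp Require Import all_algebra qpoly ring zify.
Import GRing.Theory.

Set Implicit Arguments.
Unset Strict Implicit.
Unset Printing Implicit Defensive.

(** Both sides of the theorem are coefficients of one value of the double series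
      A(a,b) = sum over N1 >= N2 >= 0 of
               q^(N1^2 + N2^2 + a N1 + b N2) / ((q)_(N1-N2) (q)_N2),
    namely of A(1,1), the case of Rogers and Selberg. Taking 1 - q^(N1-N2),
    respectively 1 - q^N2, out of the denominator gives
      A(a,b) = A(a+1,b-1) + q^(a+1) A(a+2,b),
      A(a,b) = A(a,b+1) + q^(a+b+2) A(a+2,b+2).
    These two recurrences, with the fact that A tends to 1 when a and a+b grow,
    are all that is ever used ([rs_series_shift], [rs_series_drop],
    [rs_series_ge]).

    The weighted side. Let T_m be the generating function of the partitions with
    gaps >= 2 and parts >= m, where every string has the weight F_(eta+3), and
    let V_m be that of those with smallest part exactly m, where the string of
    m has the weight F_(eta+2) instead. In a string, a gap 2 leaves the weight
    alone, and a gap 3 advances the Fibonacci index by one; so deleting the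
    smallest part, and looking whether the next gap is 2, 3 or larger, gives
    linear recurrences between the T_m and V_m. They are solved by
    T_m = A(m-1,-1) and V_m = q^m A(m+1,0) ([solve_recurrences]). The
    exceptional weights of the strings that contain 2 or 3 turn the total into
    T_4 + V_3 + q^2 (T_6 + V_5 + T_4 - T_5 - V_4), which is A(1,1) by the two
    recurrences ([weighted_sum_rs]).

    The product side. The series A(N,N), A(N,N+1), A(N+1,N+1) are the generating
    functions of Gordon's theorem modulo 7. Multiplied by the product of the
    1 - q^i for i > N, they satisfy the same recurrences in N as Andrews'
    alternating sums, hence agree with them ([rs_series_andrews]). For N = 0 the
    alternating sum is a theta series, which Jacobi's triple product identity
    turns into the product of the 1 - q^i for i = 0, 1, 6 modulo 7. Hence A(1,1)
    is the product of the 1 / (1 - q^i) for the other i, the generating function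
    of A_(7,1) ([allowed_sum_rs]).

    Power series are replaced by elements of an arbitrary commutative ring in
    which q^M = 0. Sums and products become finite there, and a recurrence that
    expresses a series by series of larger index has only one solution, found by
    descending from the indices beyond M, where every series is trivial. The
    coefficients of q^n come back by taking Z[X]/(X^(n+1)) for this ring
    ([eq_coef_of_eq_truncated]). *)

(** * The Rogers-Selberg double series *)

Section DoubleSeries.

Local Open Scope ring_scope.

Variables (R : comNzRingType) (M : nat) (q : R).
Hypothesis q_nilpotent : q ^+ M = 0.

Lemma expq_ge n : (M <= n)%N -> q ^+ n = 0.
Proof. by move=> leMn; rewrite -(subnKC leMn) exprD q_nilpotent mul0r. Qed.

(** The sum over k of q^(2k^2 + sk) / (q)_k, which collects the terms N1 = N2
    of A(a, s - a). It is computed from its recurrence, where [k] bounds the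
    number of unfoldings; the bound [M] is enough because q^M = 0. *)
Fixpoint diag_rec k s : R :=
  if k is k'.+1 then diag_rec k' s.+1 + q ^+ s.+2 * diag_rec k' (s + 4) else 1.

Definition diag_series s := diag_rec M s.

Lemma diag_recS k s : (M <= k + s)%N -> diag_rec k.+1 s = diag_rec k s.
Proof.
elim: k s => [|k IHk] s leM.
  by rewrite /= expq_ge ?mul0r ?addr0 //; lia.
rewrite -[LHS]/(diag_rec k.+1 s.+1 + q ^+ s.+2 * diag_rec k.+1 (s + 4)).
by rewrite [in LHS]IHk ?[in LHS]IHk //; lia.
Qed.

Lemma diag_seriesE s :
  diag_series s = diag_series s.+1 + q ^+ s.+2 * diag_series (s + 4).
Proof. by rewrite {1}/diag_series -diag_recS ?leq_addr. Qed.

Lemma diag_series_ge s : (M <= s)%N -> diag_series s = 1.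
Proof.
rewrite /diag_series; elim: {2}M s => //= k IHk s leMs.
by rewrite expq_ge ?mul0r ?addr0 ?IHk //; lia.
Qed.

(** [rs_series a s] is the double series A(a, s - a). In this indexing the first
    recurrence increases [a] and keeps or increases [s], so that only natural
    numbers occur, and it can serve as the definition. For a >= M the terms
    with N1 > N2 vanish, which leaves the diagonal series. *)
Fixpoint rs_rec k a s : R :=
  if k is k'.+1 then rs_rec k' a.+1 s + q ^+ a.+1 * rs_rec k' a.+2 s.+2
  else diag_series s.

Definition rs_series a s := rs_rec M a s.

Lemma rs_recS k a s : (M <= k + a)%N -> rs_rec k.+1 a s = rs_rec k a s.
Proof.
elim: k a s => [|k IHk] a s leM.
  by rewrite /= expq_ge ?mul0r ?addr0 //; lia.
rewrite -[LHS]/(rs_rec k.+1 a.+1 s + q ^+ a.+1 * rs_rec k.+1 a.+2 s.+2).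
by rewrite [in LHS]IHk ?[in LHS]IHk //; lia.
Qed.

Lemma rs_series_shift a s :
  rs_series a s = rs_series a.+1 s + q ^+ a.+1 * rs_series a.+2 s.+2.
Proof. by rewrite {1}/rs_series -rs_recS ?leq_addr. Qed.

(** The two recurrences commute: the defect of the second one satisfies the
    first one, and it vanishes on the diagonal series. *)
Lemma rs_series_drop a s :
  rs_series a s = rs_series a s.+1 + q ^+ s.+2 * rs_series a.+2 (s + 4).
Proof.
rewrite /rs_series; elim: {1 2 3}M a s => [|k IHk] a s; first exact: diag_seriesE.
rewrite /= [in LHS](IHk a.+1) [in LHS](IHk a.+2) !addSn !exprS.
by ring.
Qed.

Lemma rs_series_ge a s : (M <= a)%N -> (M <= s)%N -> rs_series a s = 1.
Proof.
move=> leMa leMs; rewrite -(diag_series_ge leMs) /rs_series.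
elim: {2}M a leMa => //= k IHk a leMa.
by rewrite IHk ?expq_ge ?mul0r ?addr0 //; lia.
Qed.

End DoubleSeries.

(** * Gaussian binomial coefficients *)

Section Gauss.

Local Open Scope ring_scope.

Variable (R : comNzRingType) (Q : R).

Fixpoint gauss n k : R :=
  match n, k with
  | _, 0 => 1
  | 0, _.+1 => 0
  | n'.+1, k'.+1 => gauss n' k' + Q ^+ k * gauss n' k
  end.

Arguments gauss : simpl never.

Definition qpoch n : R := \prod_(i < n) (1 - Q ^+ i.+1).

Lemma gauss0 n : gauss n 0 = 1.
Proof. by case: n. Qed.

Lemma gaussSS n k : gauss n.+1 k.+1 = gauss n k + Q ^+ k.+1 * gauss n k.+1.
Proof. by []. Qed.

Lemma gauss_small n k : (n < k)%N -> gauss n k = 0.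
Proof.
elim: n k => [|n IHn] [|k] //= lt_nk.
by rewrite gaussSS !IHn ?mulr0 ?addr0 //; lia.
Qed.

Lemma gaussnn n : gauss n n = 1.
Proof. by elim: n => [|n IHn] //; rewrite gaussSS IHn gauss_small // mulr0 addr0. Qed.

Lemma qpochS n : qpoch n.+1 = qpoch n * (1 - Q ^+ n.+1).
Proof. exact: big_ord_recr. Qed.

(** The closed form, with the denominators cleared. *)
Lemma gauss_qpoch m k : gauss (m + k) k * qpoch m * qpoch k = qpoch (m + k).
Proof.
elim: m k => [|m IHm].
  elim=> [|k IHk]; first by rewrite /= /qpoch big_ord0 !mulr1.
  rewrite addnS gaussSS (gauss_small (k := k.+1)) ?add0n // mulr0 addr0 !qpochS.
  by rewrite mulrA IHk add0n.
elim=> [|k IHk]; first by rewrite gauss0 addn0 /qpoch big_ord0 mul1r mulr1.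
have -> : (m.+1 + k.+1 = (m + k).+2)%N by lia.
rewrite gaussSS !qpochS.
have -> : Q ^+ (m + k).+2 = Q ^+ k.+1 * Q ^+ m.+1.
  by rewrite -exprD; congr (_ ^+ _); lia.
have := IHm k.+1; have := IHk; rewrite addSn addnS !qpochS.
move: (gauss _ k) (gauss _ k.+1) (qpoch m) (qpoch k) (qpoch (m + k)).
move: (Q ^+ m.+1) (Q ^+ k.+1) (Q ^+ (m + k).+1) => r s t x y u v w E1 E2.
have -> : (x + s * y) * (u * (1 - r)) * (v * (1 - s)) =
   (x * (u * (1 - r)) * v) * (1 - s) + s * (1 - r) * (y * u * (v * (1 - s))).
  by ring.
by rewrite E1 E2; ring.
Qed.

(** The q-binomial theorem, made homogeneous in [a] and [b] so that it can be
    used at a = Q^m without negative powers of Q. *)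
Lemma gauss_expansion n (a b : R) :
  \prod_(i < n) (a + b * Q ^+ i) =
  \sum_(k < n.+1) Q ^+ 'C(k, 2) * gauss n k * a ^+ (n - k) * b ^+ k.
Proof.
elim: n b => [|n IHn] b; first by rewrite big_ord0 big_ord1 !expr0 !mulr1.
rewrite big_ord_recl expr0 mulr1.
under eq_bigr => i _ do rewrite lift0 exprS mulrA.
rewrite IHn mulrDl mulr_sumr [in RHS]big_ord_recl mulr_sumr /=.
rewrite [X in X + _]big_ord_recl [X in _ + X]big_ord_recr /=.
rewrite !gauss0 !subn0 subnn -!addrA; congr (_ + _).
  by rewrite !expr0 !mulr1 !mul1r exprS.
rewrite [in RHS]big_ord_recr /= addrA -big_split /=; congr (_ + _).
  apply: eq_bigr => i _; rewrite /bump !leq0n !add1n gaussSS binS bin1 subSS.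
  have lt_in := ltn_ord i.
  have -> : (n - i = (n - i.+1).+1)%N by lia.
  by rewrite !exprD !exprMn !exprS; ring.
rewrite /bump !leq0n !add1n gaussSS binS bin1 !subnn (gauss_small (leqnn n.+1)).
by rewrite !exprD !exprMn !exprS; ring.
Qed.

End Gauss.

Arguments gauss : simpl never.

(** * The triple product identity *)

Section Jacobi.

Local Open Scope ring_scope.

Lemma prod_geometric (R : comNzRingType) (x Q : R) m :
  \prod_(i < m) (x * Q ^+ i) = x ^+ m * Q ^+ 'C(m, 2).
Proof.
elim: m => [|m IHm]; first by rewrite big_ord0 !expr0 mulr1.
by rewrite big_ord_recr IHm /= binS bin1 exprD exprS; ring.
Qed.

Lemma bin2D a b : ('C(a + b, 2) = 'C(a, 2) + 'C(b, 2) + a * b)%N.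
Proof.
elim: b => [|b IHb]; first by rewrite addn0 muln0 !addn0.
by rewrite addnS !binS !bin1 IHb mulnS; lia.
Qed.

Lemma bin2_sqr n : ('C(n, 2) + 'C(n, 2) + n = n * n)%N.
Proof.
elim: n => [|n IHn]; first by [].
by rewrite !binS !bin1 mulSn mulnS -IHn; lia.
Qed.

(** Cauchy's finite form of the triple product. With Q = yz, the product of the
    Q^m - y Q^i over i < 2m factors, up to a monomial, into the two products on
    the left: the factors with i >= m are multiples of the 1 - y Q^j, and those
    with i < m are multiples of the 1 - z Q^j because Q^m = (y Q^(m-1-j)) z Q^j.
    The q-binomial theorem expands the same product as a sum over k <= 2m, whose
    terms k = m - i and k = m + i + 1 are those of the two sums on the right.
    The monomial is cancelled in the end, which needs an integral domain. *)
Lemma finite_jacobi (D : idomainType) (y z : D) m : y != 0 -> z != 0 ->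
  \prod_(i < m) (1 - y * (y * z) ^+ i) * \prod_(i < m) (1 - z * (y * z) ^+ i) =
  \sum_(i < m.+1) (y * z) ^+ 'C(i, 2) * (- z) ^+ i
                   * gauss (y * z) (m + m) (m - i)
  + \sum_(i < m) (y * z) ^+ 'C(i.+1, 2) * (- y) ^+ i.+1
                  * gauss (y * z) (m + m) (m + i.+1).
Proof.
move=> y_neq0 z_neq0; set Q := y * z.
(* The monomial by which the product of the 2m factors exceeds the left side. *)
pose K := (- y) ^+ m * Q ^+ 'C(m, 2) * Q ^+ (m * m).
have K_neq0 : K != 0 by rewrite !mulf_neq0 ?expf_neq0 ?oppr_eq0 ?mulf_neq0.
apply: (mulfI K_neq0).
transitivity (\prod_(i < m + m) (Q ^+ m + - y * Q ^+ i)).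
  rewrite big_split_ord /= [X in _ = X * _](reindex_inj rev_ord_inj) /=.
  have -> : \prod_(i < m) (Q ^+ m + - y * Q ^+ (m + i)) =
            Q ^+ (m * m) * \prod_(i < m) (1 - y * Q ^+ i).
    under eq_bigr => i _.
      have -> : Q ^+ m + - y * Q ^+ (m + i) = Q ^+ m * (1 - y * Q ^+ i).
        by rewrite exprD; ring.
      over.
    by rewrite big_split /= prodr_const card_ord exprM.
  have -> : \prod_(i < m) (Q ^+ m + - y * Q ^+ (m - i.+1)) =
            (- y) ^+ m * Q ^+ 'C(m, 2) * \prod_(i < m) (1 - z * Q ^+ i).
    rewrite -prod_geometric [X in _ = X * _](reindex_inj rev_ord_inj) /= -big_split /=.
    apply: eq_bigr => i _; have lt_im := ltn_ord i.
    have {1}-> : (m = (m - i.+1 + i).+1)%N by lia.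
    by rewrite exprS exprD {1}/Q; ring.
  by rewrite /K; ring.
rewrite gauss_expansion -addSn big_split_ord /= mulrDr !mulr_sumr.
rewrite [X in X + _](reindex_inj rev_ord_inj) /=.
congr (_ + _); apply: eq_bigr => i _; have lt_im := ltn_ord i.
  rewrite subSS; set g := gauss _ _ _; rewrite -exprM /K.
  have -> : (- y) ^+ m = (- y) ^+ (m - i) * (- y) ^+ i.
    by rewrite -exprD; congr (_ ^+ _); lia.
  have Ee : ('C(m - i, 2) + m * (m + m - (m - i)) =
             'C(m, 2) + m * m + 'C(i, 2) + i)%N.
    have := bin2D (m - i) i; have := bin2_sqr i.
    have -> : (m + m - (m - i) = m + i)%N by lia.
    have : ((m - i) * i + i * i = m * i)%N by rewrite -mulnDl subnK.
    rewrite subnK // mulnDr; lia.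
  have EQ : Q ^+ i = (- z) ^+ i * (- y) ^+ i.
    by rewrite -exprMn mulrNN mulrC.
  transitivity (Q ^+ ('C(m - i, 2) + m * (m + m - (m - i))) * g
                * (- y) ^+ (m - i)); first by rewrite exprD; ring.
  by rewrite Ee !exprD EQ; ring.
rewrite addSnnS; set g := gauss _ _ _; rewrite -exprM /K exprD.
have Ee : ('C(m + i.+1, 2) + m * (m + m - (m + i.+1)) =
           'C(m, 2) + m * m + 'C(i.+1, 2))%N.
  have := bin2D m i.+1; rewrite subnDl.
  have : (m * i.+1 + m * (m - i.+1) = m * m)%N by rewrite -mulnDr subnKC.
  by lia.
transitivity (Q ^+ ('C(m + i.+1, 2) + m * (m + m - (m + i.+1))) * g
              * ((- y) ^+ m * (- y) ^+ i.+1)); first by rewrite exprD; ring.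
by rewrite Ee !exprD; ring.
Qed.

End Jacobi.

Section Transfer.
Local Open Scope ring_scope.

Lemma rmorph_gauss (R S : comNzRingType) (f : {rmorphism R -> S}) (Q : R) n k :
  f (gauss Q n k) = gauss (f Q) n k.
Proof.
elim: n k => [|n IHn] [|k]; rewrite ?gauss0 ?rmorph1 ?rmorph0 //.
by rewrite !gaussSS rmorphD rmorphM rmorphXn !IHn.
Qed.

(** An identity between polynomials in q, hence true in every commutative ring
    once it is known for the indeterminate of Z[X]. *)
Lemma finite_jacobi_exp (R : comNzRingType) (q : R) r s m :
  \prod_(i < m) (1 - q ^+ r * (q ^+ (r + s)) ^+ i)
  * \prod_(i < m) (1 - q ^+ s * (q ^+ (r + s)) ^+ i) =
  \sum_(i < m.+1) (q ^+ (r + s)) ^+ 'C(i, 2) * (- q ^+ s) ^+ i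
                   * gauss (q ^+ (r + s)) (m + m) (m - i)
  + \sum_(i < m) (q ^+ (r + s)) ^+ 'C(i.+1, 2) * (- q ^+ r) ^+ i.+1
                  * gauss (q ^+ (r + s)) (m + m) (m + i.+1).
Proof.
have [f fX] : exists f : {rmorphism {poly int} -> R}, f 'X = q.
  exists (horner_eval q \o map_poly intr : {rmorphism {poly int} -> R}).
  by rewrite /= /horner_eval map_polyX hornerX.
have X_neq0 : 'X != 0 :> {poly int} by rewrite polyX_eq0.
have := @finite_jacobi {poly int} ('X ^+ r) ('X ^+ s) m.
rewrite !expf_neq0 // => /(_ isT isT) /(congr1 f).
rewrite -exprD rmorphD !rmorph_sum => E.
transitivity (f (\prod_(i < m) (1 - 'X ^+ r * ('X ^+ (r + s)) ^+ i)
  * \prod_(i < m) (1 - 'X ^+ s * ('X ^+ (r + s)) ^+ i))).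
  by rewrite rmorphM !rmorph_prod; congr (_ * _); apply: eq_bigr => i _;
    rewrite rmorphB rmorphM !rmorphXn rmorph1 fX.
rewrite E.
by congr (_ + _); apply: eq_bigr => i _;
    rewrite !rmorphM !rmorphXn rmorphN rmorphXn rmorph_gauss rmorphXn fX.
Qed.

End Transfer.

Section Truncation.

Local Open Scope ring_scope.

Variables (R : comNzRingType) (M : nat) (q : R).
Hypothesis q_nilpotent : q ^+ M = 0.

(** If x p = x then x = x p^M = 0, so 1 - p can be cancelled. *)
Lemma mulr1B_inj p : p ^+ M = 0 -> injective (fun x : R => x * (1 - p)).
Proof.
move=> p_nil x y /eqP; rewrite -subr_eq0 -mulrBl mulrBr mulr1 subr_eq0 => /eqP E.
have: x - y = (x - y) * p ^+ M.
  by elim: M => [|n IHn]; rewrite ?mulr1 // exprS mulrA -E.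
by rewrite p_nil mulr0 => /subr0_eq.
Qed.

Lemma expqS_nil n : (q ^+ n.+1) ^+ M = 0.
Proof. by rewrite -exprM mulnC exprM q_nilpotent expr0n. Qed.

Lemma sum_trunc K (F : nat -> R) : (M <= K)%N ->
  (forall i, (M <= i)%N -> F i = 0) -> \sum_(i < K) F i = \sum_(i < M) F i.
Proof.
move=> leMK F0; rewrite -(subnKC leMK) big_split_ord /= [X in _ + X]big1 ?addr0 //.
by move=> i _; rewrite F0 ?leq_addr.
Qed.

Section InfiniteProduct.
Variables (d : nat).
Let Q := q ^+ d.+1.

Lemma qpoch_inj n : injective (fun x : R => x * qpoch Q n).
Proof.
elim: n => [|n IHn] x y; first by rewrite /qpoch big_ord0 !mulr1.
have nilQ : (Q ^+ n.+1) ^+ M = 0.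
  by rewrite -exprM mulnC exprM expqS_nil expr0n.
by rewrite qpochS !mulrA => /(mulr1B_inj nilQ)/IHn.
Qed.

Lemma qpoch_ge n : (M <= n)%N -> qpoch Q n = qpoch Q M.
Proof.
move=> leMn; rewrite -(subnKC leMn) /qpoch big_split_ord /= [X in _ * X]big1 ?mulr1 //.
by move=> i _; rewrite -exprM (expq_ge q_nilpotent) ?subr0 // mulSn; lia.
Qed.

(** The limit of a Gaussian binomial coefficient is 1 / (Q)_oo, and it
    is already attained when both indices are at least M. *)
Lemma gauss_limit m k : (M <= m)%N -> (M <= k)%N ->
  gauss Q (m + k) k * qpoch Q M = 1.
Proof.
move=> leMm leMk; apply: (@qpoch_inj k).
rewrite mul1r [in RHS]qpoch_ge // -[in RHS](@qpoch_ge (m + k)); last by lia.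
by rewrite -gauss_qpoch (qpoch_ge leMm).
Qed.

End InfiniteProduct.

(** The triple product identity for q^r, q^s and q^(r+s), with the bilateral sum
    folded: the term i of the right side joins the indices - i and i + 1. The
    finite form is used with 2M factors, because then every term that does not
    vanish has |index| <= M and hence both indices of its Gaussian coefficient
    at least M. *)
Lemma jacobi_limit r s : (0 < r)%N -> (0 < s)%N ->
  \prod_(i < M + M) (1 - q ^+ r * (q ^+ (r + s)) ^+ i)
  * \prod_(i < M + M) (1 - q ^+ s * (q ^+ (r + s)) ^+ i)
  * qpoch (q ^+ (r + s)) M =
  \sum_(i < M) (-1) ^+ i *
      (q ^+ ((r + s) * 'C(i, 2) + s * i)
       - q ^+ ((r + s) * 'C(i.+1, 2) + r * i.+1)).
Proof.
move=> r_gt0 s_gt0; rewrite finite_jacobi_exp mulrDl !mulr_suml.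
have -> : (r + s = (r + s).-1.+1)%N by lia.
set d := (r + s).-1; set Q := q ^+ d.+1.
rewrite (@sum_trunc _ (fun i => Q ^+ 'C(i, 2) * (- q ^+ s) ^+ i *
   gauss Q (M + M + (M + M)) (M + M - i) * qpoch Q M)); [|lia|].
- rewrite (@sum_trunc _ (fun i => Q ^+ 'C(i.+1, 2) * (- q ^+ r) ^+ i.+1 *
   gauss Q (M + M + (M + M)) (M + M + i.+1) * qpoch Q M)); [|lia|].
  + rewrite -big_split /=; apply: eq_bigr => i _; have lt_iM := ltn_ord i.
    have -> : (M + M + (M + M) = (M + M + i) + (M + M - i))%N by lia.
    rewrite -mulrA (@gauss_limit d (M + M + i) (M + M - i)); [|lia..].
    have -> : (M + M + i + (M + M - i) = (M + M - i.+1) + (M + M + i.+1))%N by lia.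
    rewrite -[X in _ + X]mulrA (@gauss_limit d (M + M - i.+1)); [|lia..].
    rewrite [(- q ^+ s) ^+ _]exprNn [(- q ^+ r) ^+ _]exprNn.
    rewrite [q ^+ (d.+1 * _ + s * _)]exprD [q ^+ (d.+1 * _ + _)]exprD !exprM -/Q.
    by rewrite [(-1) ^+ i.+1]exprS; ring.
  + move=> i leMi; rewrite [(- q ^+ _) ^+ _]exprNn.
    rewrite -[in X in _ * (_ * X)]exprM (expq_ge q_nilpotent) ?mulr0 ?mul0r //.
    by rewrite -[M]mul1n leq_mul //; lia.
- move=> i leMi; rewrite [(- q ^+ _) ^+ _]exprNn.
  rewrite -[in X in _ * (_ * X)]exprM (expq_ge q_nilpotent) ?mulr0 ?mul0r //.
  by rewrite -[M]mul1n leq_mul.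
Qed.

End Truncation.

(** * Andrews' alternating sums *)

Section AndrewsSums.

Local Open Scope ring_scope.

Variables (R : comNzRingType) (M : nat) (q : R).
Hypothesis q_nilpotent : q ^+ M = 0.

Lemma gauss_shift_bot N n :
  (1 - q ^+ n.+1) * gauss q (N + n.+1) n.+1 = (1 - q ^+ (N + n).+1) * gauss q (N + n) n.
Proof.
apply: (@qpoch_inj _ _ _ q_nilpotent 0 N).
apply: (@qpoch_inj _ _ _ q_nilpotent 0 n); rewrite expr1.
transitivity (qpoch q (N + n).+1).
  by rewrite -addnS -gauss_qpoch [qpoch q n.+1]qpochS; ring.
by rewrite qpochS -gauss_qpoch; ring.
Qed.

Lemma gauss_shift_top N n :
  (1 - q ^+ N.+1) * gauss q (N.+1 + n) n = (1 - q ^+ (N + n).+1) * gauss q (N + n) n.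
Proof.
apply: (@qpoch_inj _ _ _ q_nilpotent 0 N).
apply: (@qpoch_inj _ _ _ q_nilpotent 0 n); rewrite expr1.
transitivity (qpoch q (N + n).+1).
  by rewrite -addSn -gauss_qpoch [qpoch q N.+1]qpochS; ring.
by rewrite qpochS -gauss_qpoch; ring.
Qed.

Definition qtail N := \prod_(i < M) (1 - q ^+ (N + i.+1)).

Lemma qtailE N : qtail N = (1 - q ^+ N.+1) * qtail N.+1.
Proof.
have tailM : 1 - q ^+ (N.+1 + M) = 1.
  by rewrite (expq_ge q_nilpotent) ?subr0 ?leq_addl.
transitivity (\prod_(i < M.+1) (1 - q ^+ (N + i.+1))).
  by rewrite big_ord_recr /= addnS -addSn tailM mulr1.
rewrite big_ord_recl /= addn1; congr (_ * _).
by apply: eq_bigr => i _; rewrite /bump add1n addSnnS.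
Qed.

Lemma qtail_ge N : (M <= N)%N -> qtail N = 1.
Proof.
move=> leMN; apply: big1 => i _.
by rewrite (expq_ge q_nilpotent) ?subr0 //; lia.
Qed.

Lemma qtail0 : qtail 0 = qpoch q M.
Proof. by []. Qed.

(** Andrews' series J_(3,i)(x), for x = q^N and multiplied by the product of the
    1 - q^j for j > N. At such x the quotient (xq)_n / (q)_n is the Gaussian
    coefficient of N + n over n. *)
Definition andrews_sum i N :=
  \sum_(n < M) (-1) ^+ n * q ^+ (3 * N * n + 7 * 'C(n, 2) + (7 - i) * n)
                * (1 - q ^+ (i * (N + n.*2.+1))) * gauss q (N + n) n.

Lemma andrews_sum0 N : andrews_sum 0 N = 0.
Proof. by apply: big1 => n _; rewrite mul0n subrr mulr0 mul0r. Qed.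

Lemma andrews_sum_ge i N : (0 < i)%N -> (M <= N)%N -> andrews_sum i N = 1.
Proof.
case: i => // i _ leMN; rewrite /andrews_sum.
case: M leMN q_nilpotent => [|K] leMN q_nil.
  by rewrite big_ord0 -[LHS]q_nil.
rewrite big_ord_recl big1 => [|n _].
  by rewrite gauss0 !muln0 (@expq_ge _ K.+1 _ _ (i.+1 * _)%N) //=; [ring|lia].
rewrite (@expq_ge _ K.+1 _ _ (_ + _ + _)%N) ?mulr0 ?mul0r //.
by rewrite lift0 mulnS -!addnA (leq_trans leMN) //
     (leq_trans _ (leq_addr _ _)) // leq_pmull.
Qed.

(** Termwise, the difference of the sums for j + 1 and j splits into a part with
    the factor 1 - q^n, called [a], and a part with the factor 1 - q^(N+n+1),
    called [b]. The factor 1 - q^n lowers the index of the Gaussian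
    coefficient, so that [a] at n + 1 and [b] at n together make up the term n
    of the sum for N + 1. *)
Lemma andrews_sum_rec j N : (j < 3)%N ->
  andrews_sum j.+1 N =
  andrews_sum j N + q ^+ (j * N.+1) * (1 - q ^+ N.+1) * andrews_sum (3 - j) N.+1.
Proof.
move=> lt_j3.
pose t n := (-1) ^+ n * q ^+ (3 * N * n + 7 * 'C(n, 2)).
pose a n := t n * q ^+ ((6 - j) * n) * ((1 - q ^+ n) * gauss q (N + n) n).
pose b n := t n * q ^+ ((7 - j) * n + j * (N + n.*2.+1))
            * (1 - q ^+ (N + n).+1) * gauss q (N + n) n.
have Eab : andrews_sum j.+1 N = andrews_sum j N + \sum_(n < M) a n + \sum_(n < M) b n.
  rewrite -!big_split; apply: eq_bigr => n _ /=; rewrite /a /b /t.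
  have -> : (7 - j = (6 - j).+1)%N by lia.
  have -> : (7 - j.+1 = 6 - j)%N by lia.
  have -> : (j.+1 * (N + n.*2.+1) = j * (N + n.*2.+1) + (N + n).+1 + n)%N.
    by rewrite mulSn; lia.
  rewrite [((6 - j).+1 * n)%N]mulSn; move: (3 * N * n + 7 * 'C(n, 2))%N => m.
  by rewrite !exprD; ring.
have Ea : \sum_(n < M) a n = \sum_(n < M) a n.+1.
  transitivity (\sum_(n < M.+1) a n).
    rewrite big_ord_recr /= [a M]/a (@expq_ge _ M _ _ (_ * M)%N) //; last first.
      by rewrite -{1}[M]mul1n leq_mul //; lia.
    by rewrite mulr0 mul0r addr0.
  by rewrite big_ord_recl [a _]/a expr0 subrr mul0r mulr0 add0r.
rewrite Eab Ea -addrA -big_split; congr (_ + _); rewrite mulr_sumr.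
apply: eq_bigr => n _; rewrite /a /b /t gauss_shift_bot /=.
pose e := (j * N.+1 + (3 * N.+1 * n + 7 * 'C(n, 2) + (7 - (3 - j)) * n))%N.
pose d := ((3 - j) * (N.+1 + n.*2.+1))%N.
transitivity ((-1) ^+ n * q ^+ e * (1 - q ^+ d)
              * ((1 - q ^+ (N + n).+1) * gauss q (N + n) n)); last first.
  by rewrite -gauss_shift_top /e /d [q ^+ (j * _ + _)]exprD; ring.
have Eb : q ^+ e = q ^+ (3 * N * n + 7 * 'C(n, 2))
                   * q ^+ ((7 - j) * n + j * (N + n.*2.+1)).
  rewrite -exprD /e; congr (_ ^+ _).
  by case: j lt_j3 {t a b Eab Ea e d} => [|[|[|//]]] _; lia.
have Ea' : q ^+ e * q ^+ d =
    q ^+ (3 * N * n.+1 + 7 * 'C(n.+1, 2)) * q ^+ ((6 - j) * n.+1).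
  rewrite -!exprD /e /d binS bin1; congr (_ ^+ _).
  by case: j lt_j3 {t a b Eab Ea e d Eb} => [|[|[|//]]] _; lia.
rewrite exprS; transitivity ((-1) ^+ n * ((q ^+ e - q ^+ e * q ^+ d)
              * ((1 - q ^+ (N + n).+1) * gauss q (N + n) n))); last by ring.
by rewrite Ea' Eb; ring.
Qed.

(** Gordon's generating functions for i = 3, 2, 1 and parts > N are A(N,N),
    A(N,N+1) and A(N+1,N+1). Both sides satisfy the recurrences of
    [andrews_sum_rec] and are 1 when N >= M. *)
Lemma rs_series_andrews N :
  [/\ rs_series M q N N.*2 * qtail N = andrews_sum 3 N,
      rs_series M q N N.*2.+1 * qtail N = andrews_sum 2 N
    & rs_series M q N.+1 N.*2.+2 * qtail N = andrews_sum 1 N].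
Proof.
have [k le_MkN] : exists k, (M <= k + N)%N by exists M; apply: leq_addr.
elim: k N le_MkN => [|k IHk] N leM.
  by rewrite !rs_series_ge ?qtail_ge ?andrews_sum_ge ?mulr1 //; lia.
have [IH3 IH2 _] := IHk N.+1 ltac:(lia); have [_ _ IH1] := IHk N.+1 ltac:(lia).
have E1 : rs_series M q N.+1 N.*2.+2 * qtail N = andrews_sum 1 N.
  rewrite andrews_sum_rec // andrews_sum0 add0r mul0n mul1r -IH3 (qtailE N) doubleS.
  by ring.
have E2 : rs_series M q N N.*2.+1 * qtail N = andrews_sum 2 N.
  rewrite andrews_sum_rec // -E1 mul1n -IH2 !(qtailE N) doubleS.
  rewrite (rs_series_shift q_nilpotent) (rs_series_drop q_nilpotent N.+1 N.*2.+1).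
  rewrite (rs_series_shift q_nilpotent N.+1 N.*2.+3).
  have -> : (N.*2.+1 + 4 = N.*2.+3.+2)%N by lia.
  have -> : q ^+ N.*2.+3 = q ^+ N.+1 * q ^+ N.+2 by rewrite -exprD; congr (_ ^+ _); lia.
  by ring.
split=> //; rewrite andrews_sum_rec // -E2 -IH1 (rs_series_drop q_nilpotent) !(qtailE N).
rewrite mulrDl.
congr (_ + _); rewrite addn4 doubleS.
have -> : (2 * N.+1 = N.*2.+2)%N by lia.
by ring.
Qed.

Lemma rogers_selberg_product :
  rs_series M q 1 2 * qpoch q M =
  \prod_(i < M + M) (1 - q ^+ 1 * (q ^+ 7) ^+ i)
  * \prod_(i < M + M) (1 - q ^+ 6 * (q ^+ 7) ^+ i) * qpoch (q ^+ 7) M.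
Proof.
have [_ _ E] := rs_series_andrews 0; rewrite -qtail0 E.
rewrite (@jacobi_limit _ _ _ q_nilpotent 1 6) //.
apply: eq_bigr => n _; rewrite muln0 mul0n !add0n gaussnn mulr1 mul1n.
rewrite -mulrA mulrBr mulr1 -exprD.
by congr (_ * (_ - _ ^+ _)); rewrite binS bin1; lia.
Qed.

End AndrewsSums.

(** * Coefficients of truncated series *)

Section Coefficients.
Local Open Scope ring_scope.

(** The ring used is Z[X]/(X^(n+1)), with q the class of X. *)
Lemma eq_coef_of_eq_truncated n (L1 L2 : seq (seq nat)) (f1 f2 : seq nat -> nat) :
  (forall (R : comNzRingType) (q : R), q ^+ n.+1 = 0 ->
     \sum_(s <- L1) (f1 s)%:R * q ^+ sumn s =
     \sum_(s <- L2) (f2 s)%:R * q ^+ sumn s) ->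
  (\sum_(s <- L1 | sumn s == n) f1 s = \sum_(s <- L2 | sumn s == n) f2 s)%N.
Proof.
pose h : {poly int} := 'X^(n.+1).
pose gf L f : {poly int} := \sum_(s <- L) (f s)%:R * 'X^(sumn s).
have coef_gf L (f : seq nat -> nat) :
    (gf L f)`_n = (\sum_(s <- L | sumn s == n) f s)%N%:R.
  rewrite coef_sum [in RHS]big_mkcond natr_sum; apply: eq_bigr => s _.
  by rewrite -polyC_natr coefCM coefXn eq_sym; case: ifP; rewrite ?mulr1 ?mulr0.
have gfE L f : \sum_(s <- L) (f s)%:R * (in_qpoly h 'X) ^+ sumn s = in_qpoly h (gf L f).
  by rewrite rmorph_sum; apply: eq_bigr => s _; rewrite rmorphM rmorphXn rmorph_nat.
have in_qpolyE p : in_qpoly h p = take_poly n.+1 p :> {poly int}.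
  by rewrite /= mk_monic_Xn Pdiv.RingMonic.take_poly_rmodp.
move/(_ {poly %/ h} (in_qpoly h 'X)); rewrite !gfE => eq_gf.
have {}/eq_gf/(congr1 val)/= : in_qpoly h 'X ^+ n.+1 = 0 :> {poly %/ h}.
  rewrite -rmorphXn; apply/val_inj; rewrite [LHS]in_qpolyE /=.
  by apply/polyP => i; rewrite coef_take_poly coefXn coef0; case: ltngtP.
rewrite mk_monic_Xn -!Pdiv.RingMonic.take_poly_rmodp => /(congr1 (coefp n)) /=.
rewrite !coef_take_poly ltnSn !coef_gf => /eqP.
by rewrite Num.Theory.eqr_nat => /eqP.
Qed.

End Coefficients.

(** * Lists with gaps at least 2 *)

Definition gap2 : rel nat := fun x y => x + 2 <= y.

(** The increasing lists with gaps at least 2 and all parts in [m, m + k).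
    Increasing order, opposite to that of partitions, puts the smallest part at
    the head, where the recurrences remove it. *)
Fixpoint gap2_lists k m : seq (seq nat) :=
  if k is k'.+1 then gap2_lists k' m.+1 ++ [seq m :: s | s <- gap2_lists k'.-1 m.+2]
  else [:: [::]].

Lemma gap2_trans : transitive gap2.
Proof. by move=> y x z; rewrite /gap2; lia. Qed.

Lemma mem_gap2_lists k m s :
  (s \in gap2_lists k m) = sorted gap2 s && all (fun x => m <= x < m + k) s.
Proof.
have [K] := ubnP k; elim: K k m s => // K IHK [|k] m s.
  rewrite inE; case: s => //= x s _; apply/esym/negbTE/negP.
  by case/and3P=> _; rewrite addn0; lia.
rewrite ltnS => lt_kK /=; rewrite mem_cat IHK //.
case: s => [|x s] //=; rewrite path_sortedE; last exact: gap2_trans.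
have [->|ne_xm] := eqVneq x m; last first.
  rewrite (_ : x :: s \in _ = false) ?orbF; last first.
    by apply/mapP=> -[t _ [E]]; rewrite E eqxx in ne_xm.
  apply/idP/idP => /andP[/andP[gap_s srt_s] /andP[x_in range_s]].
    rewrite gap_s srt_s /=; apply/andP; split; first by lia.
    by apply: sub_all range_s => y; lia.
  rewrite gap_s srt_s /=; apply/andP; split; first by lia.
  apply/allP=> y ys; move/allP: gap_s => /(_ y ys).
  by move/allP: range_s => /(_ y ys); rewrite /gap2; lia.
rewrite ltnn andbF /= mem_map ?IHK; [|lia|by move=> ? ? []].
rewrite (_ : (_ <= m < _) = true) /=; last by lia.
rewrite andbAC -all_predI andbC; congr (_ && _); apply: eq_all => y /=.
by rewrite /gap2; lia.
Qed.

Lemma gap2_lists_uniq k m : uniq (gap2_lists k m).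
Proof.
have [K] := ubnP k; elim: K k m => // K IHK [|k] m //.
rewrite ltnS => lt_kK /=; rewrite cat_uniq IHK //=.
rewrite map_inj_uniq => [|? ? []] //; rewrite IHK ?andbT; last by lia.
apply/hasPn=> _ /mapP[s _ ->]; rewrite mem_gap2_lists /= ltnn.
by rewrite andbF.
Qed.

Section WeightedSums.

Local Open Scope ring_scope.

Variables (R : comNzRingType) (M : nat) (q : R).
Hypothesis q_nilpotent : q ^+ M = 0.

(** Parts >= M contribute 0, so the bound on the parts loses nothing. *)
Definition gap2_sum (phi : seq nat -> nat) m : R :=
  \sum_(s <- gap2_lists (M - m) m) (phi s)%:R * q ^+ sumn s.

Lemma gap2_sumE phi m :
  gap2_sum phi m = gap2_sum phi m.+1 + q ^+ m * gap2_sum (phi \o cons m) m.+2.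
Proof.
rewrite /gap2_sum; case: (ltnP m M) => [lt_mM | le_Mm]; last first.
  have -> : (M - m = 0)%N by lia.
  have -> : (M - m.+1 = 0)%N by lia.
  by rewrite (expq_ge q_nilpotent) // mul0r addr0.
have -> : (M - m = (M - m.+1).+1)%N by lia.
have -> : (M - m.+2 = (M - m.+1).-1)%N by lia.
rewrite /= big_cat big_map mulr_sumr; congr (_ + _).
by apply: eq_bigr => s _; rewrite /= exprD; ring.
Qed.

Lemma gap2_sum_ge phi m : (M <= m)%N -> gap2_sum phi m = (phi [::])%:R.
Proof.
rewrite -subn_eq0 /gap2_sum => /eqP ->.
by rewrite big_seq1 mulr1.
Qed.

Lemma eq_gap2_sum phi psi m :
  (forall s, sorted gap2 s -> all (leq m) s -> phi s = psi s) ->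
  gap2_sum phi m = gap2_sum psi m.
Proof.
move=> eq_phi; apply: eq_big_seq => s; rewrite mem_gap2_lists => /andP[gap_s range_s].
by rewrite eq_phi //; apply: sub_all range_s => x /andP[].
Qed.

Lemma gap2_sumD phi psi m :
  gap2_sum (fun s => phi s + psi s)%N m = gap2_sum phi m + gap2_sum psi m.
Proof.
by rewrite -big_split; apply: eq_bigr => s _; rewrite natrD mulrDl.
Qed.

Lemma gap2_sumZ c phi m : gap2_sum (fun s => c * phi s)%N m = c%:R * gap2_sum phi m.
Proof.
by rewrite [RHS]mulr_sumr; apply: eq_bigr => s _; rewrite natrM mulrA.
Qed.

End WeightedSums.

(** * Strings of a partition *)

Definition near3 : rel nat := fun x y => y - x <= 3.

(** Cuts an increasing list at its gaps larger than 3. The reversed blocks are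
    the strings of the reversed list ([is_string_rev]). *)
Fixpoint chop (s : seq nat) : seq (seq nat) :=
  if s isn't x :: s' then [::]
  else if chop s' is (y :: b) :: r then
    if near3 x y then [:: x, y & b] :: r else [:: [:: x], y :: b & r]
  else [:: [:: x]].

Lemma chop_nonnil s b : b \in chop s -> b != [::].
Proof.
elim: s b => //= x s IHs b; case: (chop s) IHs => [|[|y b'] r] IHs;
  try by rewrite inE => /eqP->.
case: ifP => _; rewrite inE => /predU1P[->//|].
  by move=> rb; apply: IHs; rewrite inE rb orbT.
exact: IHs.
Qed.

Lemma flatten_chop s : flatten (chop s) = s.
Proof.
elim: s => //= x s; case E: (chop s) => [|[|y b] r] /=.
- by move<-.
- by have := @chop_nonnil s [::]; rewrite E mem_head => /(_ isT).
by case: ifP => _ /= ->.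
Qed.

Lemma chop_cons x s : exists b r, chop (x :: s) = (x :: b) :: r.
Proof.
by rewrite /=; case: (chop s) => [|[|y b] r]; try case: ifP; do 2?eexists.
Qed.

Lemma chop_cons2 x y s b r : chop (y :: s) = b :: r ->
  chop [:: x, y & s] = if near3 x y then (x :: b) :: r else [:: x] :: b :: r.
Proof.
move=> E; have [b' [r' E']] := chop_cons y s.
rewrite -[LHS]/(if chop (y :: s) is (z :: b) :: r then
    if near3 x z then [:: x, z & b] :: r else [:: [:: x], z :: b & r]
  else [:: [:: x]]) E'.
by move: E; rewrite E' => -[<- <-].
Qed.

Arguments chop : simpl never.

Lemma chop_near3 s b : b \in chop s -> sorted near3 b.
Proof.
elim: s b => // x [|y s] IHs b; first by rewrite inE => /eqP->.
have [b' [r E]] := chop_cons y s; rewrite (chop_cons2 x E).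
rewrite E in IHs; case: ifP => xy3; rewrite inE => /predU1P[->|] //; last exact: IHs.
  by rewrite /= xy3; apply: (IHs (y :: b')); apply: mem_head.
by move=> rb; apply: IHs; rewrite inE rb orbT.
Qed.

(** A prefix without large gaps cannot cross the first cut. *)
Lemma chop_prefix s p : prefix p s -> sorted near3 p -> p != [::] ->
  exists2 b, b \in take 1 (chop s) & prefix p b.
Proof.
elim: s p => [|x s IHs] [|z p] //=.
case: eqP => //= -> {z} pre_p p3 _.
case: s IHs pre_p => [|y s] IHs pre_p.
  by case: p pre_p p3 => // _ _; exists [:: x]; rewrite ?mem_head // /prefix eqxx.
have [b [r E]] := chop_cons y s.
case: p pre_p p3 => [|y' p] pre_p p3.
  have [b' [r' E']] := chop_cons x (y :: s); rewrite E'.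
  by exists (x :: b'); rewrite ?mem_head //= eqxx prefix0s.
have yy' : y' = y by move: pre_p => /=; case: eqP.
subst y'; case/andP: p3 => xy3 p3; rewrite (chop_cons2 x E) xy3.
have [b'] := IHs (y :: p) pre_p p3 isT; rewrite E /= take0 inE => /eqP-> pre_b.
by exists [:: x, y & b]; rewrite ?mem_head // prefix_cons eqxx.
Qed.

Lemma chop_infix s p : infix p s -> sorted near3 p -> p != [::] ->
  exists2 b, b \in chop s & infix p b.
Proof.
elim: s p => [|x s IHs] p.
  by rewrite infixs0 => ->.
rewrite infix_consl => /orP[pre_p|inf_p] p3 p0.
  have [b /mem_take b_s /prefixW pb] := chop_prefix pre_p p3 p0.
  by exists b.
case: s IHs inf_p => [|y s] IHs inf_p.
  by rewrite infixs0 (negbTE p0) in inf_p.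
have [b] := IHs _ inf_p p3 p0.
have [b' [r E]] := chop_cons y s; rewrite (chop_cons2 x E) E.
case: ifP => _ rb pb; last by exists b; rewrite // inE rb orbT.
move: rb; rewrite inE => /predU1P[Eb|rb]; last by exists b; rewrite // inE rb orbT.
exists [:: x, y & b']; first exact: mem_head.
by rewrite infix_consl -Eb pb orbT.
Qed.

Lemma infix_flatten (T : eqType) (ss : seq (seq T)) b :
  b \in ss -> infix b (flatten ss).
Proof.
case/splitPr=> p1 p2; rewrite flatten_cat /=.
by apply/infixP; exists (flatten p1), (flatten p2).
Qed.

Lemma uniq_flatten_mem (T : eqType) (ss : seq (seq T)) b b' x :
  uniq (flatten ss) -> b \in ss -> b' \in ss -> x \in b -> x \in b' -> b = b'.
Proof.
elim: ss => //= c ss IHss; rewrite cat_uniq => /and3P[_ /hasPn disj uniq_ss].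
have disj' d : d \in ss -> x \in d -> x \notin c.
  by move=> d_ss xd; apply: disj; apply/flattenP; exists d.
rewrite !inE => /predU1P[->|b_ss] /predU1P[->|b'_ss] // xb xb'.
- by rewrite (negbTE (disj' _ b'_ss xb')) in xb.
- by rewrite (negbTE (disj' _ b_ss xb)) in xb'.
exact: IHss.
Qed.

(** Every block is an infix without large gaps, and every such infix lies in a
    single block. So strings are blocks by maximality; conversely an infix that
    extends a block lies in a block that shares an element with it, hence in
    the same block, as the parts are distinct. *)
Lemma is_string_rev s b : uniq s -> is_string (rev s) (rev b) = (b \in chop s).
Proof.
move=> uniq_s.
have gaps_rev p : gaps_le3 (rev p) = sorted near3 p by rewrite /gaps_le3 rev_sorted.
have inf_block c : c \in chop s -> infix c s.
  by move=> c_s; rewrite -[X in infix _ X]flatten_chop infix_flatten.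
apply/is_stringP/idP => [[b0 b_s b3 b_max]|b_s].
  rewrite infix_rev in b_s; rewrite gaps_rev in b3.
  have b0' : b != [::] by case: (b) b0.
  have [c c_s bc] := chop_infix b_s b3 b0'.
  rewrite -[b](can_inj revK (b_max (rev c) _ _ _)) ?infix_rev ?inf_block //.
  by rewrite gaps_rev (chop_near3 c_s).
have b0 := chop_nonnil b_s; split.
- by move/(congr1 rev); rewrite revK => Eb; rewrite Eb in b0.
- by rewrite infix_rev inf_block.
- by rewrite gaps_rev (chop_near3 b_s).
move=> phi; rewrite -[phi]revK !infix_rev gaps_rev => phi_s b_phi phi3.
congr rev.
have phi0 : rev phi != [::] by apply: contraNneq b0 => E; rewrite E infixs0 in b_phi.
have [c c_s phi_c] := chop_infix phi_s phi3 phi0.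
have bc : infix b c := infix_trans b_phi phi_c.
have Ebc : b = c.
  case: b b0 b_s bc {b_phi} => // x b _ b_s bc.
  apply: (@uniq_flatten_mem _ (chop s) _ _ x) => //; rewrite ?flatten_chop ?mem_head //.
  by apply: (mem_infix bc); apply: mem_head.
subst c; apply/eqP; rewrite -(size_subseq_leqif (infixW phi_c)).
by rewrite eqn_leq !size_infix.
Qed.

Lemma uniq_of_flatten (T : eqType) (ss : seq (seq T)) :
  [::] \notin ss -> uniq (flatten ss) -> uniq ss.
Proof.
elim: ss => //= b ss IHss; rewrite inE negb_or => /andP[b0 ss0].
rewrite cat_uniq => /and3P[_ /hasPn disj /(IHss ss0) ->]; rewrite andbT.
apply/negP=> b_ss; case: b b0 disj b_ss => // x b _ disj b_ss.
have /disj : x \in flatten ss by apply/flattenP; exists (x :: b); rewrite ?mem_head.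
by rewrite mem_head.
Qed.

Lemma omega7_rev s : uniq s ->
  omega7 (rev s) = \prod_(b <- chop s) omega7_string (rev b).
Proof.
move=> uniq_s; rewrite /omega7 -(big_map rev predT omega7_string).
apply: perm_big; apply: uniq_perm; first by rewrite filter_uniq ?undup_uniq.
  rewrite (map_inj_uniq (can_inj revK)) uniq_of_flatten ?flatten_chop //.
  by apply/negP=> /chop_nonnil.
move=> psi; rewrite mem_filter -[psi]revK is_string_rev //.
rewrite (mem_map (can_inj revK)) andb_idr // => psi_s.
by rewrite mem_segments infix_rev -[X in infix _ X]flatten_chop infix_flatten.
Qed.

Lemma eta_rev_cons2 x y b :
  eta (rev [:: x, y & b]) = (y - x == 3) + eta (rev (y :: b)).
Proof.
rewrite [rev [:: x, y & b]]rev_cons [rev (y :: b)]rev_cons.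
elim: (rev b) => [|z t IHt]; first by rewrite /eta /= addn0.
have etaE u v p : eta [:: u, v & p] = (u - v == 3) + eta (v :: p) by [].
case: t IHt => [_|w t IHt]; first by rewrite /eta /= !addn0 addnC.
by rewrite !rcons_cons in IHt *; rewrite !etaE IHt addnCA.
Qed.

Lemma chop_far x s b r : path ltn x s -> chop (x :: s) = b :: r ->
  all (leq x.+4) (flatten r).
Proof.
elim: s x b r => [|y s IHs] x b r /=; first by move=> _ [_ <-].
case/andP=> lt_xy lt_s; have [b' [r' E]] := chop_cons y s.
have far := IHs _ _ _ lt_s E; rewrite (chop_cons2 x E).
case: ifP => [_|/negbT] /=.
  by case=> _ <-; apply: sub_all far => z; lia.
rewrite /near3 => far_y [_ <-] /=; apply/andP; split; first by lia.
rewrite -/(all _ (b' ++ _)) -/(flatten (((y :: b') :: r'))).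
have: all (leq y) (y :: s).
  rewrite /= leqnn; apply: sub_all (order_path_min ltn_trans lt_s) => z; exact: ltnW.
rewrite -(flatten_chop (y :: s)) E /= => /andP[_ le_y].
by apply: sub_all le_y => z; lia.
Qed.

(** * Fibonacci weights *)

(** The product of the F_(eta+3) over all strings, except that the string of the
    smallest part gets F_(eta+c). *)
Definition fib_weight c s :=
  if chop s is b :: r then fib (eta (rev b) + c) * \prod_(b <- r) fib (eta (rev b) + 3)
  else 1.

Lemma fib_weightSS c x s :
  fib_weight c.+2 (x :: s) = fib_weight c.+1 (x :: s) + fib_weight c (x :: s).
Proof.
rewrite /fib_weight; have [b [r ->]] := chop_cons x s.
by rewrite !addnS -mulnDl.
Qed.

Lemma fib_weight_gap2 c m s :
  fib_weight c [:: m, m.+2 & s] = fib_weight c (m.+2 :: s).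
Proof.
have [b [r E]] := chop_cons m.+2 s.
rewrite /fib_weight (chop_cons2 m E) E.
have -> : near3 m m.+2 by rewrite /near3; lia.
by rewrite eta_rev_cons2; have -> : m.+2 - m = 2 by lia.
Qed.

Lemma fib_weight_gap3 c m s :
  fib_weight c [:: m, m.+3 & s] = fib_weight c.+1 (m.+3 :: s).
Proof.
have [b [r E]] := chop_cons m.+3 s.
rewrite /fib_weight (chop_cons2 m E) E.
have -> : near3 m m.+3 by rewrite /near3; lia.
rewrite eta_rev_cons2; have -> : m.+3 - m = 3 by lia.
by rewrite eqxx add1n addSnnS.
Qed.

Lemma fib_weight_far c m s : all (leq m.+4) s ->
  fib_weight c (m :: s) = fib c * fib_weight 3 s.
Proof.
case: s => [|y s]; first by rewrite /fib_weight /= big_nil.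
case/andP=> le_y _; have [b [r E]] := chop_cons y s.
rewrite /fib_weight (chop_cons2 m E) E /near3.
rewrite ifF; last by apply/negbTE; rewrite -ltnNge; lia.
by rewrite big_cons.
Qed.

(** The Fibonacci index offset of the string of the smallest part. If 2 is a
    part, then 3 is not, and 4 or 5 belongs to the string of 2 as soon as it is
    a part: the string of 2 contains 4 or 5 exactly if the next part is at
    most 5. *)
Definition start_index s :=
  match s with
  | 2 :: y :: _ => if y <= 5 then 1 else 2
  | x :: _ => if x <= 3 then 2 else 3
  | [::] => 3
  end.

Lemma omega7_fib_weight s : sorted gap2 s -> all (leq 2) s ->
  omega7 (rev s) = fib_weight (start_index s) s.
Proof.
move=> gap_s le2s; have lt_s : sorted ltn s.
  by apply: sub_sorted gap_s => x y; rewrite /gap2; lia.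
rewrite omega7_rev ?(sorted_uniq ltn_trans ltnn lt_s) //.
case: s gap_s le2s lt_s => [|x s] gap_s le2s lt_s; first by rewrite big_nil.
have [b [r E]] := chop_cons x s; have far := chop_far lt_s E.
rewrite /fib_weight E big_cons; congr (_ * _); last first.
  apply: eq_big_seq => c cr; rewrite /omega7_string all_rev.
  rewrite (_ : all _ c) //; apply/allP=> y yc; move/allP: far => /(_ y).
  have -> : y \in flatten r by apply/flattenP; exists c.
  by move/(_ isT); lia.
rewrite /omega7_string all_rev !mem_rev.
have sub_b y : y \in x :: b -> y \in x :: s.
  by rewrite -(flatten_chop (x :: s)) E /= !inE mem_cat => /orP[->//|->]; rewrite orbT.
have gap_x y : y \in s -> x.+2 <= y.
  by move/(allP (order_path_min gap2_trans gap_s)); rewrite /gap2; lia.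
case: (leqP 4 x) => [le4x | lt_x4].
  have -> : all (leq 4) (x :: b).
    apply/allP=> y /sub_b; rewrite inE => /predU1P[->//|/gap_x]; lia.
  by case: x le4x {gap_s le2s lt_s E far sub_b gap_x} => [|[|[|[|x]]]].
have {le2s} : x = 2 \/ x = 3 by case/andP: le2s => le2x _; lia.
case=> Ex; subst x; last by rewrite /= !inE eqxx orbT.
have -> : (3 \in 2 :: b) = false.
  by apply/negP=> /sub_b; rewrite inE /= => /gap_x.
rewrite orbF [2 \in _]inE eqxx /=.
case: s gap_s lt_s E sub_b gap_x => [|y s] gap_s lt_s E sub_b gap_x.
  by case: E => <- _.
have [b' [r' E']] := chop_cons y s.
have ge_y : 4 <= y by apply: gap_x; rewrite mem_head.
move: E; rewrite (chop_cons2 2 E') /near3.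
case: (leqP y 5) => [le_y5 | lt_5y].
  rewrite ifT; last by lia.
  case=> <- _; rewrite !inE.
  have [->|->] : y = 4 \/ y = 5 by lia.
    by rewrite eqxx.
  by rewrite eqxx !orbT andbF.
rewrite ifF; last by apply/negbTE; rewrite -ltnNge; lia.
by case=> <- _.
Qed.

(** * The weighted sum as a double series *)

Section Recurrences.
Local Open Scope ring_scope.
Variables (R : comNzRingType) (M : nat) (q : R).
Hypothesis q_nilpotent : q ^+ M = 0.

(** [T m] and [w 2 m] are the series T_m and V_m; [w c m] is the variant of V_m
    with offset [c]. *)
Let T m := gap2_sum M q (fib_weight 3) m.
Let w c m := q ^+ m * gap2_sum M q (fib_weight c \o cons m) m.+2.
Let sumE := gap2_sumE q_nilpotent.

Lemma totalE m : T m = T m.+1 + w 3 m.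
Proof. exact: sumE. Qed.

Lemma startSS c m : w c.+2 m = w c.+1 m + w c m.
Proof.
rewrite /w -mulrDr -gap2_sumD; congr (_ * _); apply: eq_gap2_sum => s _ _ /=.
exact: fib_weightSS.
Qed.

(** Splits by the part that follows m: at least m + 4, equal to m + 3, or equal
    to m + 2. *)
Lemma startE c m :
  w c m = q ^+ m * ((fib c)%:R * T m.+4 + w c.+1 m.+3 + w c m.+2).
Proof.
rewrite {1}/w (sumE _ m.+2) (sumE _ m.+3) /T -gap2_sumZ.
congr (_ * (_ + _ * _ + _ * _)); apply: eq_gap2_sum => s _ far /=.
- exact: fib_weight_far.
- exact: fib_weight_gap3.
exact: fib_weight_gap2.
Qed.

(** As F_2 = 1, the first two terms of [startE] recombine into T_(m+3). *)
Lemma start2E m : w 2 m = q ^+ m * (T m.+3 + w 2 m.+2).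
Proof. by rewrite startE mul1r -totalE. Qed.

Lemma total_rec m : T m = T m.+1 + q ^+ m * (T m.+2 + T m.+4 + w 2 m.+3).
Proof.
rewrite [LHS]totalE startE (startSS 2 m.+3) (totalE m.+2) (totalE m.+3).
have -> : (fib 3)%:R = 1 + 1 :> R by [].
by ring.
Qed.

(** The claim is T_m = A(m-1,-1) and V_m = q^m A(m+1,0), for m >= 2. It descends
    from m >= M, where only the empty list counts. *)
Lemma solve_recurrences m :
  T m.+2 = rs_series M q m.+1 m /\ w 2 m.+2 = q ^+ m.+2 * rs_series M q m.+3 m.+3.
Proof.
have [k] : exists k, (M <= k + m)%N by exists M; apply: leq_addr.
elim: k m => [|k IHk] m leM.
  rewrite /T /w gap2_sum_ge ?rs_series_ge ?(expq_ge q_nilpotent) ?mul0r //; lia.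
have IHT j : T (m + j).+3 = rs_series M q (m + j).+2 (m + j).+1.
  by case: (IHk (m + j).+1); first by lia.
have IHw j : w 2 (m + j).+3 = q ^+ (m + j).+3 * rs_series M q (m + j).+4 (m + j).+4.
  by case: (IHk (m + j).+1); first by lia.
have shift := rs_series_shift q_nilpotent; have drop_b := rs_series_drop q_nilpotent.
split; last first.
  rewrite start2E; have := IHT 2; have := IHw 1; rewrite !addnS addn0 => -> ->.
  by rewrite [rs_series _ _ m.+3 m.+3]shift.
rewrite total_rec; have := IHT 0; have := IHT 1; have := IHT 3; have := IHw 2.
rewrite !addnS addn0 => -> -> -> ->.
rewrite (shift m.+1 m) (drop_b m.+2 m) addn4 (shift m.+4 m.+4).
by ring.
Qed.

(** The first equation of the proof sorts the lists by their parts below 6. The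
    strings with offset 1 that start at 4 come from the lists that start with
    2, 4; those with offset 2 that start at 5 come from 2, 5, where the gap 3
    raises the offset 1. *)
Lemma weighted_sum_rs :
  gap2_sum M q (fun s => omega7 (rev s)) 2 = rs_series M q 1 2.
Proof.
have -> : gap2_sum M q (fun s => omega7 (rev s)) 2 =
          gap2_sum M q (fun s => fib_weight (start_index s) s) 2.
  by apply: eq_gap2_sum => s; apply: omega7_fib_weight.
have -> : gap2_sum M q (fun s => fib_weight (start_index s) s) 2 =
          T 4 + w 2 3 + q ^+ 2 * (T 6 + w 2 5 + w 1 4).
  rewrite (sumE _ 2) (sumE _ 3) (sumE (_ \o cons 2%N) 4) (sumE (_ \o cons 2%N) 5) /T /w.
  congr (_ + _ * _ + _ * (_ + _ * _ + _ * _)); apply: eq_gap2_sum => s _ /= far.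
  - case: s far => [|x s] //= /andP[le4x _].
    by case: x le4x => [|[|[|[|x]]]].
  - rewrite -[RHS]mul1n -(fib_weight_far 2 far).
    by case: s far => [|[|[|[|[|[|[|x]]]]]] s].
  - by rewrite fib_weight_gap3.
  by rewrite fib_weight_gap2.
have -> : w 1 4 = T 4 - T 5 - w 2 4.
  by rewrite (totalE 4) (startSS 1 4); ring.
have [T4 w4] := solve_recurrences 2; have [_ w3] := solve_recurrences 1.
have [T5 w5] := solve_recurrences 3; have [T6 _] := solve_recurrences 4.
rewrite T4 T5 T6 w3 w4 w5.
have shift := rs_series_shift q_nilpotent; have drop_b := rs_series_drop q_nilpotent.
rewrite (shift 1 2) (shift 2 2) (shift 3 4) (shift 4 4)
  (shift 3 2) (drop_b 4 2) (drop_b 5 4).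
rewrite (shift 5 6).
by ring.
Qed.

End Recurrences.

(** * Partitions into parts not congruent to 0, 1, 6 modulo 7 *)

Definition allowed p := p %% 7 \notin [:: 0; 1; 6].

(** The decreasing lists of allowed parts <= m in which each part occurs fewer
    than K times, built by the choice of a multiplicity for each part, as in
    the expansion of the product of geometric series. *)
Fixpoint allowed_lists K m : seq (seq nat) :=
  if m is m'.+1 then
    if allowed m then [seq nseq j m ++ s | j <- iota 0 K, s <- allowed_lists K m']
    else allowed_lists K m'
  else [:: [::]].

Lemma allowed_lists_sound K m s : s \in allowed_lists K m ->
  [/\ sorted geq s, all (fun x => 0 < x <= m) s & all allowed s].
Proof.
elim: m s => [|m IHm] s; first by rewrite inE => /eqP->.
have weaken t : t \in allowed_lists K m ->
    [/\ sorted geq t, all (fun x => 0 < x <= m.+1) t & all allowed t].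
  by move=> /IHm[-> le_t ->]; split=> //; apply: sub_all le_t => x; lia.
rewrite /=; case: ifP => [ok_m|_]; last exact: weaken.
case/allpairsP=> -[j t] [_ /= t_m ->]; have [srt_t le_t ok_t] := weaken t t_m.
have geq_trans : transitive geq by move=> y x z; rewrite /=; lia.
elim: j => //= j [srt le_jt ok_jt]; rewrite ok_m ok_jt le_jt ltnS leqnn; split=> //.
rewrite path_sortedE // srt andbT; apply: sub_all le_jt => x /=; lia.
Qed.

Lemma split_max m s : sorted geq s -> all (geq m.+1) s ->
  exists j t, [/\ s = nseq j m.+1 ++ t, sorted geq t & all (geq m) t].
Proof.
elim: s => [|x s IHs] /= srt; first by exists 0, [::].
case/andP=> le_x le_s; have [j [t [Es srt_t le_t]]] := IHs (path_sorted srt) le_s.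
have [->|ne_x] := eqVneq x m.+1; first by exists j.+1, t; rewrite Es.
exists 0, (x :: s); split=> //=; apply/andP; split; first by lia.
have geq_trans : transitive geq by move=> y z ?; rewrite /=; lia.
by apply: sub_all (order_path_min geq_trans srt) => y /=; lia.
Qed.

Lemma allowed_lists_complete K m s : size s < K -> sorted geq s ->
  all (fun x => 0 < x <= m) s -> all allowed s -> s \in allowed_lists K m.
Proof.
elim: m s => [|m IHm] s lt_sK srt le_s ok_s.
  by case: s le_s {lt_sK srt ok_s} => //= x s; rewrite leqn0; case: x.
have le_s' : all (geq m.+1) s by apply: sub_all le_s => x /andP[].
have [j [t [Es srt_t le_t]]] := split_max srt le_s'.
subst s; move: lt_sK le_s ok_s; rewrite size_cat size_nseq !all_cat.
move=> lt_sK /andP[_ pos_t] /andP[ok_j ok_t].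
have t_mults : t \in allowed_lists K m.
  apply: IHm => //; first by lia.
  apply/allP=> x xt; move/allP: le_t => /(_ x xt); move/allP: pos_t => /(_ x xt) /=.
  by lia.
rewrite /=; case: ifP => ok_m.
  by apply/allpairsP; exists (j, t); rewrite mem_iota /= add0n; split=> //; lia.
by case: j ok_j {lt_sK srt le_s'} => //= j; rewrite ok_m.
Qed.

Lemma allowed_lists_uniq K m : uniq (allowed_lists K m).
Proof.
elim: m => // m IHm; rewrite /=; case: ifP => // _.
apply: allpairs_uniq => //; first exact: iota_uniq.
have count0 t : t \in allowed_lists K m -> count_mem m.+1 t = 0.
  case/allowed_lists_sound=> _ le_t _; apply/eqP; rewrite -leqn0 leqNgt -has_count.
  by apply/hasPn=> x xt; apply: contraTneq xt => ->; apply/negP=> /(allP le_t); lia.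
move=> [i s] [j t] /allpairsP[[? ?] [_ s_m [-> ->]]].
move=> /allpairsP[[? ?] [_ t_m [-> ->]]] /= E.
have Eij := congr1 (count_mem m.+1) E.
rewrite !count_cat !count_nseq !count0 //= eqxx !mul1n !addn0 in Eij.
by rewrite Eij in E *; move/eqP: E; rewrite eqseq_cat // eqxx => /eqP->.
Qed.

Section ProductSide.
Local Open Scope ring_scope.
Variables (R : comNzRingType) (M : nat) (q : R).
Hypothesis q_nilpotent : q ^+ M = 0.

Lemma allowed_lists_gf m : \sum_(s <- allowed_lists M m) q ^+ sumn s =
  \prod_(i < m) (if allowed i.+1 then \sum_(j < M) (q ^+ i.+1) ^+ j else 1).
Proof.
elim: m => [|m IHm]; first by rewrite big_seq1 big_ord0.
rewrite big_ord_recr /= -IHm; case: ifP => _; last by rewrite mulr1.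
rewrite big_allpairs_dep mulrC mulr_suml -[M in iota 0 M]subn0 -/(index_iota 0 M).
rewrite big_mkord; apply: eq_bigr => j _; rewrite mulr_sumr.
by apply: eq_bigr => s _; rewrite sumn_cat sumn_nseq exprD exprM.
Qed.

Lemma allowed_lists_gf_qpoch m :
  (\sum_(s <- allowed_lists M m) q ^+ sumn s) * qpoch q m =
  \prod_(i < m) (if allowed i.+1 then 1 else 1 - q ^+ i.+1).
Proof.
rewrite allowed_lists_gf -big_split; apply: eq_bigr => i _ /=.
case: ifP => _; last exact: mul1r.
have := subrX1 (q ^+ i.+1) M; rewrite expqS_nil // => E.
by rewrite mulrC -opprB mulNr -E; ring.
Qed.

(** Groups the factors by blocks of seven consecutive i. *)
Lemma forbidden_prod K :
  \prod_(i < 7 * K) (if allowed i.+1 then 1 else 1 - q ^+ i.+1) =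
  \prod_(i < K) (1 - q ^+ 1 * (q ^+ 7) ^+ i)
  * \prod_(i < K) (1 - q ^+ 6 * (q ^+ 7) ^+ i) * qpoch (q ^+ 7) K.
Proof.
rewrite /qpoch; elim: K => [|K IHK]; first by rewrite muln0 !big_ord0 !mulr1.
have allowedE r : allowed (7 * K + r).+1 = allowed r.+1.
  by rewrite /allowed -addnS mulnC modnMDl.
rewrite mulnS addnC big_split_ord /= IHK.
under [X in _ * X = _]eq_bigr => r _ do rewrite allowedE -addnS exprD exprM.
rewrite !(big_ord_recr K) /= [(q ^+ 7) ^+ K.+1]exprSr.
move: (\prod_(i < K) _) (\prod_(i < K) _) (\prod_(i < K) _) => x y z.
by rewrite !big_ord_recr big_ord0 /=; ring.
Qed.

(** Both sides become the product over the residues 0, 1, 6 when multiplied by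
    the product of all 1 - q^i. The parts are bounded by 7 * 2M to match the 2M
    factors of each kind in [rogers_selberg_product]. *)
Lemma allowed_sum_rs :
  \sum_(s <- allowed_lists M (7 * (M + M))) q ^+ sumn s = rs_series M q 1 2.
Proof.
apply: (@qpoch_inj _ M q q_nilpotent 0 (7 * (M + M))); rewrite expr1.
rewrite allowed_lists_gf_qpoch forbidden_prod.
rewrite (@qpoch_ge _ M q q_nilpotent 6 (M + M)); last by lia.
rewrite -rogers_selberg_product //; congr (_ * _).
by have := @qpoch_ge _ M q q_nilpotent 0 (7 * (M + M)); rewrite expr1 => -> //; lia.
Qed.

End ProductSide.

(** * Partitions of a fixed number *)

Lemma sum_partitions n (P : pred (seq nat)) (f : seq nat -> nat) L :
  uniq L -> (forall s, (s \in L) = [&& is_partition s, sumn s == n & P s]) ->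
  \sum_(b in partitions n | P (parts b)) f (parts b) = \sum_(s <- L) f s.
Proof.
move=> uniq_L mem_L; rewrite -big_enum_cond -big_filter.
rewrite -(big_map (@parts n) predT f); apply/perm_big/uniq_perm => //.
  by rewrite (map_inj_uniq (@parts_inj n)) filter_uniq ?enum_uniq.
move=> s; rewrite mem_L; apply/mapP/and3P => [[b]|[is_s /eqP sum_s Ps]].
  by rewrite mem_filter mem_enum inE => /andP[Pb /andP[is_b sum_b]] ->.
have [b b_part Es] := bseq_to_partition is_s sum_s.
by exists b; rewrite // mem_filter mem_enum Es Ps.
Qed.

Lemma partition_size s : is_partition s -> size s <= sumn s.
Proof.
by case/andP=> _; elim: s => //= x s IHs /andP[x_gt0 /IHs]; lia.
Qed.

Lemma partition_leq s x : x \in s -> x <= sumn s.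
Proof.
by elim: s => //= y s IHs; rewrite inE => /predU1P[->|/IHs]; lia.
Qed.

Lemma A7_1_allowed_lists n :
  A7_1 n = \sum_(s <- allowed_lists n.+1 (7 * (n.+1 + n.+1)) | sumn s == n) 1.
Proof.
rewrite /A7_1 -sum1_card.
transitivity (\sum_(b in partitions n | all allowed (parts b)) 1).
  by apply: eq_bigl => b; rewrite !inE.
rewrite -[RHS]big_filter; apply: (@sum_partitions n (all allowed) (fun=> 1)).
  by rewrite filter_uniq ?allowed_lists_uniq.
move=> s; rewrite mem_filter.
apply/andP/and3P => [[sum_s /allowed_lists_sound[srt le_s ok_s]]|].
  split=> //; rewrite /is_partition srt; apply: sub_all le_s => x; lia.
case=> is_s /[dup] sum_s /eqP sumE ok_s; split=> //.
have [srt pos] := andP is_s; apply: allowed_lists_complete => //.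
  by rewrite ltnS -sumE partition_size.
apply/allP=> x xs; have := partition_leq xs; rewrite sumE.
by move/allP: pos => /(_ x xs); lia.
Qed.

Lemma R2E s : R2 (rev s) = sorted gap2 s && all (leq 2) s.
Proof.
rewrite /R2 /is_partition rev_sorted all_rev mem_rev.
rewrite -sorted_pairwise; last by move=> y x z; lia.
rewrite rev_sorted -/gap2; apply/and3P/andP => [[/andP[_ pos] gap_s not1]|[gap_s le2]].
  split=> //; apply/allP=> x xs; move/allP: pos => /(_ x xs).
  by have : x != 1 by [apply: contraNneq not1 => <-]; lia.
split=> //; last by apply/negP=> /(allP le2).
rewrite (sub_sorted _ gap_s) /=; last by move=> x y; rewrite /gap2; lia.
by apply: sub_all le2 => x; lia.
Qed.

Lemma R2_gap2_lists n :
  \sum_(b in partitions n | R2 (parts b)) omega7 (parts b) =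
  \sum_(s <- gap2_lists (n.+1 - 2) 2 | sumn s == n) omega7 (rev s).
Proof.
rewrite -[RHS]big_filter -[RHS](big_map rev predT omega7); apply: sum_partitions.
  by rewrite (map_inj_uniq (can_inj revK)) filter_uniq ?gap2_lists_uniq.
move=> s; rewrite -[s]revK; move: (rev s) => t {s}.
rewrite (mem_map (can_inj revK)) mem_filter sumn_rev R2E mem_gap2_lists.
apply/and3P/and3P => [[sum_t gap_t range_t]|[is_t sum_t /andP[gap_t le2]]].
  have le2 : all (leq 2) t by apply: sub_all range_t => x /andP[].
  split=> //; last by rewrite gap_t.
  by have /and3P[] : R2 (rev t) by rewrite R2E gap_t.
split=> //; apply/allP=> x xt; have := partition_leq xt; rewrite (eqP sum_t).
by move/allP: le2 => /(_ x xt); lia.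
Qed.

Theorem theorem7 (n : nat) :
  A7_1 n = \sum_(b in partitions n | R2 (parts b)) omega7 (parts b).
Proof.
rewrite A7_1_allowed_lists R2_gap2_lists; apply: eq_coef_of_eq_truncated => R q q_nil.
have := weighted_sum_rs q_nil; rewrite /gap2_sum => ->; rewrite -allowed_sum_rs //.
by apply: eq_bigr => s _; rewrite mul1r.
Qed.
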